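(* Let $\mathcal{CW}$ be a free $\mathbb{C}[\partial]$-module with basis $\{L_i \mid i\in\mathbb{Z}\}$. Then $\mathcal{CW}$ carries the structure of a Lie conformal algebra whose $\lambda$-bracket has the form $$[L_i\,{}_\lambda\,L_j]=\big(f(i,j)\partial+g(i,j)\lambda\big)L_{i+j}\quad (i,j\in\mathbb{Z})$$ for some polynomials $f(x,y),g(x,y)\in\mathbb{C}[x,y]$, if and only if there exist $a,c\in\mathbb{C}$ such that $$[L_i\,{}_\lambda\,L_j]=\Big((ai+c)\partial+(a(i+j)+2c)\lambda\Big)L_{i+j}\quad\text{for all } i,j\in\mathbb{Z}.$$
   Context: A Lie conformal algebra is a $\mathbb{C}[\partial]$-module $R$ with a linear map $R\otimes R\to R[\lambda]=\mathbb{C}[\lambda]\otimes R$, $a\otimes b\mapsto[a\,{}_\lambda\,b]$ (the $\lambda$-bracket), such that for all $a,b,c\in R$: (conformal sesquilinearity) $[\partial a\,{}_\lambda\,b]=-\lambda[a\,{}_\lambda\,b]$ and $[a\,{}_\lambda\,\partial b]=(\partial+\lambda)[a\,{}_\lambda\,b]$; (skew symmetry) $[a\,{}_\lambda\,b]=-[b\,{}_{-\lambda-\partial}\,a]$; (Jacobi identity) $[a\,{}_\lambda\,[b\,{}_\mu\,c]]=[[a\,{}_\lambda\,b]\,{}_{\lambda+\mu}\,c]+[b\,{}_\mu\,[a\,{}_\lambda\,c]]$. A $\lambda$-bracket on a free $\mathbb{C}[\partial]$-module is determined by its values on a basis, extended by conformal sesquilinearity. *)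

(* Defs.v *)
From HB Require Import structures.
From mathcomp Require Import all_boot all_order all_algebra.
From mathcomp Require Import finmap complex reals monalg.
Set Implicit Arguments.
Unset Strict Implicit.
Unset Printing Implicit Defensive.
Import GRing.Theory.
Local Open Scope ring_scope.

(* M[X] = A[X] \otimes_A M for a left A-module M: finitely supported sequences
   of coefficients in M, where p@_k (monalg's mcoeff) is the coefficient of
   X^k.  It is made into a left {poly A}-module below, so that the construction
   can be iterated: M[X][Y] is a left {poly {poly A}}-module. *)
Definition polymod (A : nzRingType) (M : lmodType A) : Type := {malg M[nat]}.

HB.instance Definition _ (A : nzRingType) (M : lmodType A) :=
  GRing.Zmodule.copy (polymod M) {malg M[nat]}.

Section PolyMod.
Variables (A : nzRingType) (M : lmodType A).
Implicit Types (p q : {poly A}) (g h : polymod M) (v : M).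

Definition constpm v : polymod M := << v *g 0%N >>.

Definition pmscale p g : polymod M :=
  \sum_(k <- msupp g) \sum_(i < size p) << p`_i *: g@_k *g (i + k)%N >>.

Lemma pmscaleE p g n :
  (pmscale p g)@_n = \sum_(i < n.+1) p`_i *: g@_(n - i)%N.
Proof.
rewrite /pmscale raddf_sum /=.
transitivity (\sum_(k <- msupp g) \sum_(i < n.+1)
    (p`_i *: g@_k *+ (i + k == n)%N)).
  apply: eq_bigr => k _; rewrite raddf_sum /=.
  under eq_bigr => i _ do rewrite mcoeffU.
  rewrite -(big_mkord predT (fun i => p`_i *: g@_k *+ (i + k == n)%N)).
  rewrite -(big_mkord predT (fun i => p`_i *: g@_k *+ (i + k == n)%N)).
  rewrite (big_nat_widen 0 (size p) (maxn (size p) n.+1)) ?leq_maxl //.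
  rewrite (big_nat_widen 0 n.+1 (maxn (size p) n.+1)) ?leq_maxr //.
  rewrite big_mkcond [RHS]big_mkcond; apply: eq_bigr => i _ /=.
  case: ltnP => hi; case: ltnP => hn //.
    by case: eqP => // e; move: hn; rewrite -e ltnNge leq_addr.
  by rewrite nth_default // scale0r mul0rn.
rewrite exchange_big /=; apply: eq_bigr => i _.
have hi : (i <= n)%N by rewrite -ltnS ltn_ord.
have E k : (i + k == n)%N = (k == n - i)%N.
  by rewrite -(eqn_add2l i k) subnKC.
under eq_bigr => k _ do rewrite E mulrb.
rewrite -big_mkcond /=.
case: (boolP ((n - i)%N \in msupp g)) => hs.
  by rewrite -big_filter filter_pred1_uniq ?finmap.fset_uniq // big_seq1.
rewrite mcoeff_outdom // scaler0 big_seq_cond big1 // => k /andP[hk /eqP kE].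
by move: hk; rewrite kE (negbTE hs).
Qed.

Fact pmscaleA p q g : pmscale p (pmscale q g) = pmscale (p * q) g.
Proof.
apply/malgP => n; rewrite !pmscaleE.
transitivity (\sum_(i < n.+1) \sum_(j < n.+1)
   if (i <= j)%N then (p`_i * q`_(j - i)) *: g@_(n - j)%N else 0).
  apply: eq_bigr => i _; rewrite pmscaleE scaler_sumr.
  have hi : (i <= n)%N by rewrite -ltnS ltn_ord.
  rewrite -(big_mkord predT
    (fun j => if (i <= j)%N then (p`_i * q`_(j - i)) *: g@_(n - j)%N else 0)).
  rewrite (@big_cat_nat _ _ _ i) //=; last exact: leqW.
  rewrite [in RHS]big_nat_cond [in RHS]big1 ?add0r; last first.
    by move=> j /andP[/andP[_ ji] _]; rewrite leqNgt ji.
  rewrite -[X in \sum_(X <= _ < _) _]add0n big_addn subSn // big_mkord.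
  apply: eq_bigr => j _.
  by rewrite leq_addl addnK scalerA (addnC (j : nat)) subnDA.
rewrite exchange_big /=; apply: eq_bigr => j _.
rewrite coefM scaler_suml -big_mkcond /=.
have hj : (j < n.+1)%N := ltn_ord j.
rewrite -(big_mkord (fun i => i <= j)%N
  (fun i => (p`_i * q`_(j - i)) *: g@_(n - j)%N)).
rewrite -(big_mkord predT (fun i => (p`_i * q`_(j - i)) *: g@_(n - j)%N)).
rewrite [RHS](big_nat_widen 0 j.+1 n.+1) //.
Qed.

Fact pmscale1 : left_id 1 pmscale.
Proof.
move=> g; apply/malgP => n; rewrite pmscaleE big_ord_recl /= coef1 scale1r subn0.
by rewrite big1 ?addr0 // => i _; rewrite coef1 /= scale0r.
Qed.

Fact pmscaleDr : right_distributive pmscale +%R.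
Proof.
move=> p g h; apply/malgP => n; rewrite pmscaleE mcoeffD !pmscaleE -big_split.
by apply: eq_bigr => i _; rewrite mcoeffD scalerDr.
Qed.

Fact pmscaleDl g : {morph pmscale^~ g : p q / p + q}.
Proof.
move=> p q; apply/malgP => n; rewrite mcoeffD !pmscaleE -big_split.
by apply: eq_bigr => i _; rewrite coefD scalerDl.
Qed.

End PolyMod.

HB.instance Definition _ (A : nzRingType) (M : lmodType A) :=
  GRing.Zmodule_isLmodule.Build {poly A} (polymod M)
    (@pmscaleA A M) (@pmscale1 A M) (@pmscaleDr A M) (@pmscaleDl A M).

(* \sum_k s^k h(p_k) for p = \sum_k X^k p_k: substitute s for X in p, after
   applying h to the coefficients.  N need not be a module over A. *)
Definition evalpm (A S : nzRingType) (M : lmodType A) (N : lmodType S)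
    (s : S) (h : M -> N) (p : polymod M) : N :=
  \sum_(k <- msupp p) s ^+ k *: h p@_k.

(* C[\partial] is {poly K}, with \partial = 'X.  For V a C[\partial]-module,
   V[\lambda] is polymod V, acted upon by C[\partial][\lambda] =
   {poly {poly K}}, in which \partial = 'X%:P and \lambda = 'X.  V[\lambda,\mu]
   is polymod (polymod V), acted upon by {poly {poly {poly K}}}, in which
   \lambda = 'X%:P and \mu = 'X. *)
Section LieConformal.
Variables (K : comNzRingType) (V : lmodType {poly K}).
Implicit Types (br : V -> V -> polymod V) (a b c : V).

Record lambda_bracket br : Prop := LambdaBracket {
  bracketDl : forall a a' b, br (a + a') b = br a b + br a' b;
  bracketDr : forall a b b', br a (b + b') = br a b + br a b';
  bracketZl : forall (k : K) a b, br (k%:P *: a) b = k%:P%:P *: br a b;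
  bracketZr : forall (k : K) a b, br a (k%:P *: b) = k%:P%:P *: br a b;
  bracket_partiall : forall a b, br ('X *: a) b = - 'X *: br a b;
  bracket_partialr : forall a b, br a ('X *: b) = ('X%:P + 'X) *: br a b
}.

Definition skew_symmetry br : Prop :=
  forall a b, br a b = - evalpm (- 'X - 'X%:P) (@constpm _ V) (br b a).

(* bracket_at br s a b is [a _s b] in V[\lambda,\mu]. *)
Definition bracket_at br (s : {poly {poly {poly K}}}) a b :
    polymod (polymod V) :=
  evalpm s (fun v => constpm (constpm v)) (br a b).

(* Outer brackets with one argument in V[\lambda] or V[\mu] are extended
   linearly in that variable, whence the outermost evalpm of each term. *)
Definition jacobi_identity br : Prop :=
  let lam : {poly {poly {poly K}}} := 'X%:P in
  let mu : {poly {poly {poly K}}} := 'X in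
  forall a b c,
    evalpm mu (fun v => bracket_at br lam a v) (br b c) =
    evalpm lam (fun v => bracket_at br (lam + mu) v c) (br a b) +
    evalpm lam (fun v => bracket_at br mu b v) (br a c).

Record lie_conformal_algebra br : Prop := LieConformalAlgebra {
  lca_bracket : lambda_bracket br;
  lca_skew : skew_symmetry br;
  lca_jacobi : jacobi_identity br
}.

End LieConformal.

Definition is_basis (A : nzRingType) (M : lmodType A) (I : eqType)
    (e : I -> M) : Prop :=
  (forall v, exists (s : seq I) (p : I -> A), v = \sum_(i <- s) p i *: e i) /\
  (forall (s : seq I) (p : I -> A), uniq s ->
     \sum_(i <- s) p i *: e i = 0 -> forall i, i \in s -> p i = 0).

(* x \partial + y \lambda *)
Definition partial_lambda (K : nzRingType) (x y : K) : {poly {poly K}} :=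
  (x *: 'X)%:P + y%:P *: 'X.

(* Main.v *)
From HB Require Import structures.
Require Import Defs.
From mathcomp Require Import all_boot all_order all_algebra.
From mathcomp Require Import finmap complex reals monalg ring polyXY.
Set Implicit Arguments.
Unset Strict Implicit.
Unset Printing Implicit Defensive.
Import GRing.Theory Num.Theory.
Local Open Scope ring_scope.

(** The classification is a computation with structure constants.  Both
    skew symmetry and the Jacobi identity compare expressions that are
    additive in each argument and turn the action of the derivation on that
    argument into multiplication by a fixed polynomial, the same on the two
    sides: for instance -lambda for the first argument of the Jacobi identity,
    and partial + lambda + mu for the third.  This is the predicate
    [subst_linear]; two such maps that agree on a basis agree
    ([subst_linear_eq]), so the axioms need only be tested on the L_i
    ([skew_symmetry_basis], [jacobi_identity_basis]).  Conversely such maps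
    can be prescribed freely on a basis, which gives a lambda-bracket with any
    table of values ([lambda_bracket_exists]).

    On the L_i, write F(i,j) and G(i,j) for the coefficients of partial and
    lambda in the bracket of L_i and L_j.  Skew symmetry says
    G(i,j) = F(i,j) + F(j,i), and the Jacobi identity is an equation between
    polynomials in partial, lambda and mu ([jacobi_outerE],
    [jacobi_innerE]).  For F(i,j) = a i + c it is an identity of commutative
    rings, which proves one direction.

    For the other direction, the coefficient of lambda^2 reads
      F(j,k) G(i,j+k) = F(j,i) G(i+j,k).
    If G is not identically zero, comparing degrees in k shows that F does not
    depend on its second argument ([free_of_second_variable]); say
    F(i,j) = phi(i).  Then G(i,j) = phi(i) + phi(j), and cancelling phi(j),
    which is nonzero for almost every j, leaves
      phi(i) + phi(j+k) = phi(i+j) + phi(k),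
    so that phi is affine ([additive_up_to_const_affine]).  If G = 0, then the
    coefficient of partial lambda at i = j gives F(j,k) F(j,j+k) = 0, whence
    F = 0. *)

(** * Sums over the support of a finitely supported family *)

Section MalgSums.
Variables (I : choiceType) (G N : zmodType).
Implicit Types (g : {malg G[I]}) (F : I -> G -> N).

Lemma malg_sum_widen F g (E : {fset I}) :
    (forall i, F i 0 = 0) -> (msupp g `<=` E)%fset ->
  \sum_(i <- msupp g) F i g@_i = \sum_(i <- E) F i g@_i.
Proof.
move=> F0 sgE; apply: big_fset_incl => // i _ /mcoeff_outdom ->; exact: F0.
Qed.

Lemma malg_sumD F g g' : (forall i, {morph F i : v w / v + w}) ->
  \sum_(i <- msupp (g + g')) F i (g + g')@_i =
  \sum_(i <- msupp g) F i g@_i + \sum_(i <- msupp g') F i g'@_i.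
Proof.
move=> FD; have F0 i : F i 0 = 0 by apply: (addrI (F i 0)); rewrite -FD !addr0.
rewrite (malg_sum_widen F0 (msuppD_le g g')).
rewrite (malg_sum_widen F0 (fsubsetUl (msupp g) (msupp g'))).
rewrite (malg_sum_widen F0 (fsubsetUr (msupp g) (msupp g'))) -big_split /=.
by apply: eq_bigr => i _; rewrite mcoeffD FD.
Qed.

Lemma malg_sumU F i v : (forall i, F i 0 = 0) ->
  \sum_(j <- msupp << v *g i >>) F j << v *g i >>@_j = F i v.
Proof.
move=> F0; rewrite (malg_sum_widen F0 (@msuppU_le _ _ i v)).
by rewrite big_seq_fset1 mcoeffUU.
Qed.

(** Every linearity property of [evalpm] and of the module structure of
    [polymod] is checked on monomials through this principle. *)
Lemma malg_additive_eq (h1 h2 : {malg G[I]} -> N) :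
    {morph h1 : g g' / g + g'} -> {morph h2 : g g' / g + g'} ->
  (forall v i, h1 << v *g i >> = h2 << v *g i >>) -> h1 =1 h2.
Proof.
move=> h1D h2D hU g.
have h10 : h1 0 = 0 by apply: (addrI (h1 0)); rewrite -h1D !addr0.
have h20 : h2 0 = 0 by apply: (addrI (h2 0)); rewrite -h2D !addr0.
rewrite (monalgE g) (big_morph _ h1D h10) (big_morph _ h2D h20).
by apply: eq_bigr => i _.
Qed.

End MalgSums.

(** * Polynomials with coefficients in a module *)

Section PolyModules.
Variables (A : nzRingType) (M : lmodType A).
Implicit Types (g : polymod M) (v w : M).

Lemma pmX_U v k : 'X *: (<< v *g k >> : polymod M) = << v *g k.+1 >>.
Proof.
apply/malgP => n; rewrite [LHS]pmscaleE mcoeffU.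
case: n => [|n]; first by rewrite big_ord1 coefX scale0r.
rewrite big_ord_recl coefX scale0r add0r big_ord_recl coefX scale1r /=.
rewrite big1 ?addr0 => [|i _]; last by rewrite coefX scale0r.
by rewrite mcoeffU subSS subn0 eqSS.
Qed.

Lemma pmC_U a v k :
  a%:P *: (<< v *g k >> : polymod M) = << a *: v *g k >>.
Proof.
apply/malgP => n; rewrite [LHS]pmscaleE mcoeffU big_ord_recl coefC subn0 /=.
rewrite big1 ?addr0 => [|i _]; last by rewrite coefC scale0r.
by rewrite mcoeffU scalerMnr.
Qed.

Lemma constpmD : {morph @constpm A M : v w / v + w}.
Proof. by move=> v w; apply: monalgUD. Qed.

Lemma constpmZ a v : constpm (a *: v) = a%:P *: constpm v.
Proof. by rewrite pmC_U. Qed.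

Lemma scale_constpm_coef (p : {poly A}) v n : (p *: constpm v)@_n = p`_n *: v.
Proof.
rewrite [LHS]pmscaleE big_ord_recr /= subnn mcoeffUU big1 ?add0r // => i _.
by rewrite mcoeffU eq_sym subn_eq0 leqNgt ltn_ord scaler0.
Qed.

(** Iterating this once for each of lambda and mu turns an equality of
    multiples of a basis vector into an equality of polynomials. *)
Lemma scale_constpm_inj v :
    injective (fun a : A => a *: v) ->
  injective (fun p : {poly A} => p *: constpm v).
Proof.
move=> vinj p q /(congr1 (fun g : polymod M => mcoeff _ g)) pq.
by apply/polyP => n; apply: vinj; rewrite -!scale_constpm_coef pq.
Qed.

End PolyModules.

Section Evaluation.
Variables (A : nzRingType) (S : comNzRingType) (M : lmodType A) (N : lmodType S).
Variable s : S.
Implicit Types (h : M -> N) (g : polymod M).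

Lemma evalpmD h : {morph h : v w / v + w} ->
  {morph evalpm s h : g g' / g + g'}.
Proof.
move=> hD g g'; apply: (malg_sumD (F := fun k v => s ^+ k *: h v)) => k v w.
by rewrite hD scalerDr.
Qed.

Lemma evalpmU h v k : {morph h : v w / v + w} ->
  evalpm s h << v *g k >> = s ^+ k *: h v.
Proof.
move=> hD; apply: (malg_sumU (F := fun k v => s ^+ k *: h v)) => {}k.
have ->: h 0 = 0; last by rewrite scaler0.
by apply: (addrI (h 0)); rewrite -hD !addr0.
Qed.

Lemma evalpm_const h v : {morph h : v w / v + w} ->
  evalpm s h (constpm v) = h v.
Proof. by move=> hD; rewrite evalpmU // scale1r. Qed.

Lemma evalpmX h g : {morph h : v w / v + w} ->
  evalpm s h ('X *: g) = s *: evalpm s h g.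
Proof.
move=> hD; move: g; apply: malg_additive_eq => [g g'|g g'|v k].
- by rewrite scalerDr evalpmD.
- by rewrite evalpmD // scalerDr.
- by rewrite pmX_U !evalpmU // exprS scalerA.
Qed.

(** Coefficients of the polynomial variable act before the substitution, so
    a scalar [a] of the source becomes whatever [h] makes of it. *)
Lemma evalpmC h a b g : {morph h : v w / v + w} ->
    (forall v, h (a *: v) = b *: h v) ->
  evalpm s h (a%:P *: g) = b *: evalpm s h g.
Proof.
move=> hD hab; move: g; apply: malg_additive_eq => [g g'|g g'|v k].
- by rewrite scalerDr evalpmD.
- by rewrite evalpmD // scalerDr.
- by rewrite pmC_U !evalpmU // hab !scalerA mulrC.
Qed.

End Evaluation.

(** * Maps that substitute a polynomial for the derivation *)

(** For a ring morphism [iota], the maps that are semilinear along the ring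
    morphism from K[partial] extending [iota] and sending partial to [x].  Only the generators of
    K[partial] are mentioned: this is the form in which sesquilinearity of a
    lambda-bracket is given, and equality of the morphisms attached to two
    maps is then just equality of the two values of [x]. *)
Record subst_linear (K : nzRingType) (V : lmodType {poly K})
    (S : nzRingType) (N : lmodType S) (iota : K -> S) (x : S) (h : V -> N) :
    Prop := SubstLinear {
  substD : {morph h : v w / v + w};
  substZ : forall k v, h (k%:P *: v) = iota k *: h v;
  substX : forall v, h ('X *: v) = x *: h v
}.

Section SubstLinear.
Variables (K : nzRingType) (V : lmodType {poly K}).
Variables (S : comNzRingType) (N : lmodType S) (iota : K -> S).
Implicit Types (x : S) (h : V -> N).

Lemma subst_linear0 x h : subst_linear iota x h -> h 0 = 0.
Proof. by case=> hD _ _; apply: (addrI (h 0)); rewrite -hD !addr0. Qed.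

Lemma subst_linearN x h : subst_linear iota x h ->
  subst_linear iota x (fun v => - h v).
Proof.
move=> [hD hZ hX]; split=> [v w|k v|v]; first by rewrite hD opprD.
  by rewrite hZ scalerN.
by rewrite hX scalerN.
Qed.

Lemma subst_linear_add x h1 h2 :
    subst_linear iota x h1 -> subst_linear iota x h2 ->
  subst_linear iota x (fun v => h1 v + h2 v).
Proof.
move=> [D1 Z1 X1] [D2 Z2 X2]; split=> [v w|k v|v].
- by rewrite D1 D2 addrACA.
- by rewrite Z1 Z2 scalerDr.
- by rewrite X1 X2 scalerDr.
Qed.

Lemma subst_linear_eq (I : eqType) (e : I -> V) x h1 h2 : is_basis e ->
    subst_linear iota x h1 -> subst_linear iota x h2 ->
  (forall i, h1 (e i) = h2 (e i)) -> h1 =1 h2.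
Proof.
move=> [spanE _] H1 H2 eqE.
have eqZ p v : h1 v = h2 v -> h1 (p *: v) = h2 (p *: v).
  move=> eqv; elim/poly_ind: p => [|p k IHp].
    by rewrite scale0r (subst_linear0 H1) (subst_linear0 H2).
  case: H1 H2 IHp => [D1 Z1 X1] [D2 Z2 X2] IHp.
  by rewrite scalerDl commr_polyX -scalerA D1 D2 Z1 Z2 X1 X2 IHp eqv.
move=> v; have [s [p ->]] := spanE v.
rewrite (big_morph h1 (substD H1) (subst_linear0 H1)).
rewrite (big_morph h2 (substD H2) (subst_linear0 H2)).
by apply: eq_bigr => i _; apply: eqZ.
Qed.

(** Brackets of brackets: if [F] makes partial act by [y] and [y] acts after
    substitution as [z], so does partial on the composite. *)
Lemma subst_linear_evalpm (W : lmodType {poly K}) s x y z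
    (F : W -> polymod V) h :
    subst_linear iota x h -> subst_linear (fun k => k%:P%:P) y F ->
    (forall g, evalpm s h (y *: g) = z *: evalpm s h g) ->
  subst_linear iota z (fun w => evalpm s h (F w)).
Proof.
move=> [hD hZ hX] [FD FZ FX] hy; split=> [v w|k v|v].
- by rewrite FD evalpmD.
- by rewrite FZ (@evalpmC _ _ _ _ _ _ _ (iota k)).
- by rewrite FX hy.
Qed.

(** Linearity in a parameter of the map applied to the coefficients, as
    opposed to linearity in the polynomial that is evaluated. *)
Lemma evalpm_subst_linear (A : nzRingType) (M : lmodType A) s x
    (h : V -> M -> N) g :
    (forall v, subst_linear iota x (h^~ v)) ->
  subst_linear iota x (fun w => evalpm s (h w) g).
Proof.
move=> H; split=> [v w|k v|v].
- rewrite /evalpm -big_split /=; apply: eq_bigr => n _.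
  by rewrite (substD (H _)) scalerDr.
- rewrite /evalpm scaler_sumr; apply: eq_bigr => n _.
  by rewrite (substZ (H _)) !scalerA mulrC.
- rewrite /evalpm scaler_sumr; apply: eq_bigr => n _.
  by rewrite (substX (H _)) !scalerA mulrC.
Qed.

Lemma evalpm_plusX s x h g : subst_linear iota x h ->
  evalpm s h (('X%:P + 'X) *: g) = (x + s) *: evalpm s h g.
Proof.
case=> hD hZ hX.
by rewrite scalerDl evalpmD // (@evalpmC _ _ _ _ _ _ _ x) // evalpmX // scalerDl.
Qed.

Lemma evalpm_oppX s x h g : subst_linear iota x h ->
  evalpm s h (- 'X *: g) = - s *: evalpm s h g.
Proof.
case=> hD _ _; apply: (addIr (s *: evalpm s h g)).
rewrite -scalerDl addNr scale0r -evalpmX // -evalpmD // -scalerDl addNr scale0r.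
by apply: (addrI (evalpm s h 0)); rewrite -evalpmD // !addr0.
Qed.

Lemma evalpm_partial_lambda s x h (f g : K) v : subst_linear iota x h ->
  evalpm s h (partial_lambda f g *: constpm v) =
  (iota f * x + iota g * s) *: h v.
Proof.
case=> hD hZ hX; rewrite /partial_lambda -!mul_polyC [in LHS]scalerDl evalpmD //.
rewrite (@evalpmC _ _ _ _ _ _ _ (iota f * x)) // => [|w]; last first.
  by rewrite -!scalerA hZ hX.
rewrite -(scalerA g%:P%:P) (@evalpmC _ _ _ _ _ _ _ (iota g)) // evalpmX //.
rewrite evalpm_const //.
by rewrite scalerA -scalerDl.
Qed.

End SubstLinear.

(** * The axioms need only hold on a basis *)

Section Brackets.
Variables (K : comNzRingType) (V : lmodType {poly K}).
Variable br : V -> V -> polymod V.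
Hypothesis hbr : lambda_bracket br.
Implicit Types (a b c v : V).

Let poly2C (k : K) : {poly {poly K}} := k%:P%:P.
Let poly3C (k : K) : {poly {poly {poly K}}} := k%:P%:P%:P.
Let del : {poly {poly {poly K}}} := 'X%:P%:P.
Let lam : {poly {poly {poly K}}} := 'X%:P.
Let mu : {poly {poly {poly K}}} := 'X.

Lemma bracket_l b : subst_linear poly2C (- 'X) (br^~ b).
Proof. by case: hbr => Dl _ Zl _ Xl _;
  split=> [v w|k v|v]; rewrite ?Dl ?Zl ?Xl.
Qed.

Lemma bracket_r a : subst_linear poly2C ('X%:P + 'X) (br a).
Proof. by case: hbr => _ Dr _ Zr _ Xr;
  split=> [v w|k v|v]; rewrite ?Dr ?Zr ?Xr.
Qed.

Lemma constpm_subst_linear : subst_linear poly2C 'X%:P (@constpm _ V).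
Proof. by split=> [v w|k v|v]; rewrite ?constpmD ?constpmZ. Qed.

Lemma constpm2_subst_linear :
  subst_linear poly3C del (fun v => constpm (constpm v)).
Proof. by split=> [v w|k v|v]; rewrite ?constpmD ?constpmZ. Qed.

Lemma bracket_at_l s b : subst_linear poly3C (- s) (fun a => bracket_at br s a b).
Proof.
apply: (subst_linear_evalpm constpm2_subst_linear (bracket_l b)) => g.
exact: evalpm_oppX constpm2_subst_linear.
Qed.

Lemma bracket_at_r s a : subst_linear poly3C (del + s) (bracket_at br s a).
Proof.
apply: (subst_linear_evalpm constpm2_subst_linear (bracket_r a)) => g.
exact: evalpm_plusX constpm2_subst_linear.
Qed.

Section Basis.
Variables (I : eqType) (e : I -> V).
Hypothesis he : is_basis e.

(** Substituting -lambda - partial for lambda exchanges the actions -lambda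
    and partial + lambda of the derivation on the two arguments of the
    bracket, so both sides of skew symmetry are linear in the same way. *)
Lemma skew_symmetry_basis :
    (forall i j, br (e i) (e j) =
       - evalpm (- 'X - 'X%:P) (@constpm _ V) (br (e j) (e i))) ->
  skew_symmetry br.
Proof.
move=> skewE a b.
have Hl c : subst_linear poly2C (- 'X)
    (fun v => - evalpm (- 'X - 'X%:P) (@constpm _ V) (br c v)).
  apply/subst_linearN/(subst_linear_evalpm constpm_subst_linear (bracket_r c)).
  move=> g; rewrite (evalpm_plusX _ _ constpm_subst_linear); congr (_ *: _).
  by rewrite addrC subrK.
have Hr c : subst_linear poly2C ('X%:P + 'X)
    (fun v => - evalpm (- 'X - 'X%:P) (@constpm _ V) (br v c)).
  apply/subst_linearN/(subst_linear_evalpm constpm_subst_linear (bracket_l c)).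
  move=> g; rewrite (evalpm_oppX _ _ constpm_subst_linear); congr (_ *: _).
  by rewrite opprB opprK.
apply: (subst_linear_eq he (bracket_l b) (Hl b)) => i.
by apply: (subst_linear_eq he (bracket_r _) (Hr _)) => j.
Qed.

Let jac_ab_c a b c := evalpm mu (bracket_at br lam a) (br b c).
Let jac_abc a b c :=
  evalpm lam (fun v => bracket_at br (lam + mu) v c) (br a b) +
  evalpm lam (bracket_at br mu b) (br a c).

(** In each of the three terms of the Jacobi identity the derivation acts by
    -lambda on the first argument, by -mu on the second and by
    partial + lambda + mu on the third. *)
Lemma jacobi_identity_basis :
    (forall i j k, jac_ab_c (e i) (e j) (e k) = jac_abc (e i) (e j) (e k)) ->
  jacobi_identity br.
Proof.
move=> jacE ? ? a b c; change (jac_ab_c a b c = jac_abc a b c).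
have La x y : subst_linear poly3C (- lam) (fun v => jac_ab_c v x y).
  by apply: evalpm_subst_linear => v; apply: bracket_at_l.
have Ra x y : subst_linear poly3C (- lam) (fun v => jac_abc v x y).
  apply: subst_linear_add.
    apply: (subst_linear_evalpm (bracket_at_l _ _) (bracket_l _)) => g.
    exact: evalpm_oppX (bracket_at_l _ _).
  apply: (subst_linear_evalpm (bracket_at_r _ _) (bracket_l _)) => g.
  exact: evalpm_oppX (bracket_at_r _ _).
have Lb x y : subst_linear poly3C (- mu) (fun v => jac_ab_c x v y).
  apply: (subst_linear_evalpm (bracket_at_r _ _) (bracket_l _)) => g.
  exact: evalpm_oppX (bracket_at_r _ _).
have Rb x y : subst_linear poly3C (- mu) (fun v => jac_abc x v y).
  apply: subst_linear_add.
    apply: (subst_linear_evalpm (bracket_at_l _ _) (bracket_r _)) => g.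
    (* [b] enters the inner bracket on the right, as partial + lambda, and
       partial then acts by -(lambda + mu) through the outer bracket *)
    rewrite (evalpm_plusX _ _ (bracket_at_l _ _)); congr (_ *: _).
    by rewrite opprD addrAC addNr add0r.
  by apply: evalpm_subst_linear => v; apply: bracket_at_l.
have Lc x y : subst_linear poly3C (del + lam + mu) (jac_ab_c x y).
  apply: (subst_linear_evalpm (bracket_at_r _ _) (bracket_r _)) => g.
  exact: evalpm_plusX (bracket_at_r _ _).
have Rc x y : subst_linear poly3C (del + lam + mu) (jac_abc x y).
  apply: subst_linear_add.
    by apply: evalpm_subst_linear => v; rewrite -addrA; apply: bracket_at_r.
  apply: (subst_linear_evalpm (bracket_at_r _ _) (bracket_r _)) => g.
  by rewrite (evalpm_plusX _ _ (bracket_at_r _ _)) addrAC.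
apply: (subst_linear_eq he (La b c) (Ra b c)) => i.
apply: (subst_linear_eq he (Lb _ c) (Rb _ c)) => j.
by apply: (subst_linear_eq he (Lc _ _) (Rc _ _)) => k.
Qed.
End Basis.

Lemma bracket_at_partial_lambda s a b v (f g : K) :
    br a b = partial_lambda f g *: constpm v ->
  bracket_at br s a b =
  (poly3C f * del + poly3C g * s) *: constpm (constpm v).
Proof.
by rewrite /bracket_at => ->; exact: evalpm_partial_lambda constpm2_subst_linear.
Qed.

Lemma evalpm_bracket_at_r s t a b c v (f g : K) :
    br b c = partial_lambda f g *: constpm v ->
  evalpm t (bracket_at br s a) (br b c) =
  (poly3C f * (del + s) + poly3C g * t) *: bracket_at br s a v.
Proof. by move=> ->; exact: evalpm_partial_lambda (bracket_at_r _ _). Qed.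

Lemma evalpm_bracket_at_l s t a b c v (f g : K) :
    br a b = partial_lambda f g *: constpm v ->
  evalpm t (fun w => bracket_at br s w c) (br a b) =
  (poly3C f * - s + poly3C g * t) *: bracket_at br s v c.
Proof. by move=> ->; exact: evalpm_partial_lambda (bracket_at_l _ _). Qed.

End Brackets.

(** * Brackets with prescribed values on a basis *)

Section Extension.
Variables (K : nzRingType) (V : lmodType {poly K}).
Variables (I : choiceType) (e : I -> V).
Hypothesis he : is_basis e.

(* [comb] is a linear isomorphism from finitely supported families of
   coefficients; [coords], its inverse, comes from the choice operator *)
Let comb (x : {malg {poly K}[I]}) : V := \sum_(i <- msupp x) x@_i *: e i.

Let combD : {morph comb : x y / x + y}.
Proof.
move=> x y; apply: (malg_sumD (F := fun i p => p *: e i)) => i p q.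
exact: scalerDl.
Qed.

Let combU p i : comb << p *g i >> = p *: e i.
Proof.
by apply: (malg_sumU (F := fun i p => p *: e i)) => j; rewrite scale0r.
Qed.

Let malgZU p q i : p *: << q *g i >> = << p * q *g i >> :> {malg {poly K}[I]}.
Proof. by apply/malgP => j; rewrite mcoeffZ !mcoeffU mulrnAr. Qed.

Let comb0 : comb 0 = 0.
Proof. by rewrite /comb msupp0 big_seq_fset0. Qed.

Let comb_inj x y : comb x = comb y -> x = y.
Proof.
move=> exy; apply/eqP; rewrite -subr_eq0; apply/eqP; move: (x - y) (subrK y x).
move=> z zE; move: exy; rewrite -zE combD => /(canRL (addrK _)).
rewrite subrr => z0; apply/malgP => i; rewrite mcoeff0.
case: msuppP => // /((proj2 he) _ (fun i => z@_i)); apply=> //.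
Qed.

Let comb_surj v : exists x, comb x == v.
Proof.
have [s [p ->]] := proj1 he v; exists (\sum_(i <- s) << p i *g i >>).
rewrite (big_morph comb combD comb0).
by apply/eqP/eq_bigr => i _; rewrite combU.
Qed.

Let coords v : {malg {poly K}[I]} := xchoose (comb_surj v).

Let coordsK v : comb (coords v) = v.
Proof. exact: (eqP (xchooseP (comb_surj v))). Qed.

Let combK x : coords (comb x) = x.
Proof. by apply: comb_inj; rewrite coordsK. Qed.

Let coordsD : {morph coords : v w / v + w}.
Proof. by move=> v w; apply: comb_inj; rewrite combD !coordsK. Qed.

Let coordsZ p v : coords (p *: v) = p *: coords v.
Proof.
apply: comb_inj; rewrite coordsK -[in LHS](coordsK v); move: (coords v) => x.
move: x; apply: malg_additive_eq => [x y|x y|q i].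
- by rewrite combD scalerDr.
- by rewrite scalerDr combD.
- by rewrite malgZU !combU scalerA.
Qed.

Section Extend.
Variables (S : comNzRingType) (N : lmodType S).
Variables (iota : {rmorphism K -> S}) (x : S).

(** The map that is [subst_linear iota x] with value [y i] at [e i]. *)
Definition basis_extend (y : I -> N) v : N :=
  \sum_(i <- msupp (coords v)) (map_poly iota (coords v)@_i).[x] *: y i.

Lemma basis_extend_subst_linear y : subst_linear iota x (basis_extend y).
Proof.
pose E (c : {malg {poly K}[I]}) : N :=
  \sum_(i <- msupp c) (map_poly iota c@_i).[x] *: y i.
have ED : {morph E : c d / c + d}.
  move=> c d.
  apply: (malg_sumD (F := fun i p => (map_poly iota p).[x] *: y i)) => i p q.
  by rewrite rmorphD hornerD scalerDl.
have EU p i : E << p *g i >> = (map_poly iota p).[x] *: y i.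
  apply: (malg_sumU (F := fun i p => (map_poly iota p).[x] *: y i)) => j.
  by rewrite rmorph0 horner0 scale0r.
have EZ (p : {poly K}) (c : {malg {poly K}[I]}) :
    E (p *: c) = (map_poly iota p).[x] *: E c.
  move: c; apply: malg_additive_eq => [c d|c d|q i].
  - by rewrite scalerDr ED.
  - by rewrite ED scalerDr.
  - by rewrite malgZU !EU scalerA rmorphM hornerM.
split=> [v w|k v|v]; rewrite /basis_extend -!/(E _).
- by rewrite coordsD ED.
- by rewrite coordsZ EZ map_polyC hornerC.
- by rewrite coordsZ EZ map_polyX hornerX.
Qed.

Lemma basis_extendE y i : basis_extend y (e i) = y i.
Proof.
have -> : e i = comb << 1 *g i >> by rewrite combU scale1r.
rewrite /basis_extend combK.
rewrite (malg_sumU (F := fun i p => (map_poly iota p).[x] *: y i)).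
  by rewrite rmorph1 hornerC scale1r.
by move=> j; rewrite rmorph0 horner0 scale0r.
Qed.

Lemma basis_extend_param (W : lmodType {poly K}) z (y : I -> W -> N) v :
    (forall i, subst_linear iota z (y i)) ->
  subst_linear iota z (fun w => basis_extend (fun i => y i w) v).
Proof.
move=> H; split=> [w w'|k w|w]; rewrite /basis_extend ?scaler_sumr.
- rewrite -big_split /=; apply: eq_bigr => i _.
  by rewrite (substD (H i)) scalerDr.
- by apply: eq_bigr => i _; rewrite (substZ (H i)) !scalerA mulrC.
- by apply: eq_bigr => i _; rewrite (substX (H i)) !scalerA mulrC.
Qed.

End Extend.
End Extension.

(** Extend the table [P] in the second argument, then in the first; the
    result stays linear in the second argument by [basis_extend_param]. *)
Lemma lambda_bracket_exists (K : comNzRingType) (V : lmodType {poly K})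
    (I : choiceType) (e : I -> V) (P : I -> I -> polymod V) :
    is_basis e ->
  exists br, lambda_bracket br /\ forall i j, br (e i) (e j) = P i j.
Proof.
move=> he; pose poly2C : {rmorphism K -> {poly {poly K}}} := polyC \o polyC.
pose br_basis i := basis_extend he poly2C ('X%:P + 'X) (P i).
pose br v w := basis_extend he poly2C (- 'X) (fun i => br_basis i w) v.
have [Hl Hr] : (forall w, subst_linear poly2C (- 'X) (br^~ w)) /\
               (forall v, subst_linear poly2C ('X%:P + 'X) (br v)).
  split=> v; first exact: basis_extend_subst_linear.
  by apply: basis_extend_param => i; apply: basis_extend_subst_linear.
exists br; split; last first.
  by move=> i j; rewrite /br basis_extendE /br_basis basis_extendE.
split=> [a a' b|a b b'|k a b|k a b|a b|a b].
- exact: substD (Hl b) _ _.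
- exact: substD (Hr a) _ _.
- exact: substZ (Hl b) _ _.
- exact: substZ (Hr a) _ _.
- exact: substX (Hl b) _.
- exact: substX (Hr a) _.
Qed.

(** * Solving the equations for the structure constants *)

(** With [d], [l], [u] for partial, lambda, mu, these are the coefficients of
    L_(i+j+k) in [L_i _lambda [L_j _mu L_k]] and in
    [[L_i _lambda L_j] _(lambda+mu) L_k] + [L_j _mu [L_i _lambda L_k]]. *)
Section Equations.
Variables (S : comNzRingType) (F G : int -> int -> S).

Definition jacobi_outer (i j k : int) (d l u : S) : S :=
  (F j k * (d + l) + G j k * u) * (F i (j + k) * d + G i (j + k) * l).

Definition jacobi_inner (i j k : int) (d l u : S) : S :=
  (F i j * - (l + u) + G i j * l) *
    (F (i + j) k * d + G (i + j) k * (l + u)) +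
  (F i k * (d + u) + G i k * l) * (F j (i + k) * d + G j (i + k) * u).

End Equations.

Section IntegerPoints.
Variable K : numDomainType.
Implicit Types p : {poly K}.

Lemma poly_int_neq0 p : p != 0 -> exists n : int, p.[n%:~R] != 0.
Proof.
move=> p0; pose rs : seq K := [seq n%:R | n <- iota 0 (size p)].
have: ~~ all (root p) rs.
  apply: contra p0 => pr; apply/eqP; apply: (roots_geq_poly_eq0 pr) => //.
    rewrite map_inj_uniq ?iota_uniq // => m n /eqP.
    by rewrite eqr_nat => /eqP.
  by rewrite size_map size_iota.
rewrite -has_predC => /hasP[x /mapP[n _ ->] pn].
by exists n%:Z; rewrite pmulrn in pn.
Qed.

Lemma poly_int_eq0 p : (forall n : int, p.[n%:~R] = 0) -> p = 0.
Proof.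
move=> p0; apply/eqP/negPn/negP => /poly_int_neq0[n].
by rewrite p0 eqxx.
Qed.

(** Where p(j) is nonzero, p(i + j) - p(i) does not depend on i.  Two
    consecutive such j exist because p(x) p(x + 1) is a nonzero polynomial,
    and subtracting shows that p(i + 1) - p(i) is constant. *)
Lemma additive_up_to_const_affine p :
    (forall i j k : int,
       p.[j%:~R] * (p.[i%:~R] + p.[(j + k)%:~R]) =
       p.[j%:~R] * (p.[(i + j)%:~R] + p.[k%:~R])) ->
  exists a, forall n : int, p.[n%:~R] = a * n%:~R + p.[0].
Proof.
move=> pE; have [->|p0] := eqVneq p 0.
  by exists 0 => n; rewrite !horner0 mul0r addr0.
have shift j i : p.[j%:~R] != 0 ->
    p.[(i + j)%:~R] = p.[i%:~R] + (p.[j%:~R] - p.[0]).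
  move=> pj; have := mulfI pj (pE i j 0); rewrite addr0 mulr0z addrA => ->.
  by rewrite addrK.
have [J] : exists J : int, (p * (p \Po ('X + 1%:P))).[J%:~R] != 0.
  apply: poly_int_neq0; rewrite mulf_neq0 //.
  by rewrite -size_poly_eq0 size_comp_poly2 ?size_XaddC // size_poly_eq0.
rewrite hornerM horner_comp hornerD hornerX hornerC mulf_eq0 negb_or.
rewrite -[X in _ + X](mulr1z 1) -intrD => /andP[pJ pJ1].
pose a := p.[(J + 1)%:~R] - p.[J%:~R]; exists a.
have step n : p.[(n + 1)%:~R] = p.[n%:~R] + a.
  apply: (addIr (p.[J%:~R] - p.[0])); rewrite -(shift _ _ pJ).
  rewrite -addrA (addrC 1 J) (shift _ _ pJ1) /a; ring.
elim/int_rec => [|n IHn|n IHn]; first by rewrite mulr0z mulr0 add0r.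
  by rewrite -addn1 PoszD step IHn intrD; ring.
apply: (addIr a); rewrite -step.
have ->: - n.+1%:Z + 1 = - n%:Z by rewrite -addn1 PoszD; ring.
by rewrite IHn -addn1 PoszD opprD intrD; ring.
Qed.

Variables f g : {poly {poly K}}.
Let F (m n : int) := f.[m%:~R, n%:~R].
Let G (m n : int) := g.[m%:~R, n%:~R].

(** As polynomials in k, F(j,k) G(i,j+k) and F(j,i) G(i+j,k) agree.  If
    F(j,k) had positive degree in k, then G(i+j,.) would have a larger degree
    than G(i,.) whenever the latter is nonzero, and the degrees of G(i0 + nj,.)
    would grow without bound, whereas they are at most the degree of [g] in its
    second variable. *)
Lemma free_of_second_variable :
    (forall i j k, F j k * G i (j + k) = F j i * G (i + j) k) ->
    (exists i k, G i k != 0) ->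
  forall j k, F j k = F j 0.
Proof.
move=> FG [i0 [k0 G0]] j.
pose Fp : {poly K} := f.[j%:~R%:P].
pose Gp (i : int) : {poly K} := g.[i%:~R%:P].
have GpE i : Fp * (Gp i \Po ('X + j%:~R%:P)) = F j i *: Gp (i + j).
  apply/eqP; rewrite -subr_eq0; apply/eqP/poly_int_eq0 => k.
  rewrite hornerD hornerN hornerM hornerZ horner_comp hornerD hornerX hornerC.
  by rewrite -intrD (addrC k) -/(F j k) -/(G i (j + k)) FG subrr.
have sz1 : (size Fp <= 1)%N.
  rewrite leqNgt; apply/negP => sz2.
  have grow n : (n < size (Gp (i0 + j *+ n)%R))%N.
    elim: n => [|n IHn].
      rewrite mulr0n addr0 lt0n size_poly_eq0; apply: contraNneq G0 => G0.
      by rewrite /G -/(Gp i0) G0 horner0.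
    have := congr1 (fun p : {poly K} => size p) (GpE (i0 + j *+ n)).
    rewrite size_mul ?size_comp_poly2 ?size_XaddC //; first last.
    - rewrite -size_poly_eq0 size_comp_poly2 ?size_XaddC // -lt0n.
      exact: leq_ltn_trans IHn.
    - by rewrite -size_poly_eq0 -lt0n (ltn_trans _ sz2).
    rewrite -addrA -mulrSr => szE.
    have := size_scale_leq (F j (i0 + j *+ n)) (Gp (i0 + j *+ n.+1)).
    rewrite -szE; apply: leq_trans.
    by rewrite -ltnS prednK ?addn_gt0 ?(ltn_trans _ sz2) // -addn2 addnC leq_add.
  have := leq_trans (grow (sizeY g)) (max_size_evalC g _).
  by rewrite ltnn.
by move=> k; rewrite /F -/Fp (size1_polyC sz1) !hornerC.
Qed.

Lemma jacobi_solutions :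
    (forall m n, G m n = F m n + F n m) ->
    (forall i j k d l u,
       jacobi_outer F G i j k d l u = jacobi_inner F G i j k d l u) ->
  exists a c, forall m n : int,
    F m n = a * m%:~R + c /\ G m n = a * (m + n)%:~R + 2 * c.
Proof.
move=> skew jac.
have FG i j k : F j k * G i (j + k) = F j i * G (i + j) k.
  (* the values at [d = u = 0], [l = 1] give the coefficient of lambda^2 *)
  have := jac i j k 0 1 0; rewrite /jacobi_outer /jacobi_inner.
  rewrite !(mulr0, mulr1, addr0, add0r) => ->.
  by rewrite (skew i j); ring.
have [Gn0|G0] := boolp.EM (exists m n, G m n != 0); last first.
  have {}G0 m n : G m n = 0.
    by apply/eqP/negPn/negP => Gmn; apply: G0; exists m, n.
  have F0 j : F j j = 0.
    by apply/eqP; have /eqP := skew j j; rewrite G0 eq_sym -mulr2n mulrn_eq0.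
  have FF j k : F j k * F j (j + k) = 0.
    (* with G = 0 and [u = 0], the coefficients of partial^2 and of
       partial lambda add up to 2 X = X, where X is the product to be killed *)
    have := jac j j k 1 1 0; rewrite /jacobi_outer /jacobi_inner !G0 F0.
    rewrite !(mulr0, mulr1, mul0r, addr0, add0r) mulrDr mulr1 mulrDl.
    by move/(canRL (addrK _)); rewrite subrr.
  exists 0, 0 => m n; rewrite G0 !mul0r !mulr0 !addr0; split=> //.
  pose Fp : {poly K} := f.[m%:~R%:P].
  suff Fp0 : Fp = 0 by rewrite /F -/Fp Fp0 horner0.
  have /eqP : Fp * (Fp \Po ('X + m%:~R%:P)) = 0.
    apply: poly_int_eq0 => k.
    rewrite hornerM horner_comp hornerD hornerX hornerC -intrD (addrC k).
    exact: FF.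
  rewrite mulf_eq0 => /orP[/eqP //|].
  by rewrite -size_poly_eq0 size_comp_poly2 ?size_XaddC // size_poly_eq0 => /eqP.
have Fcst := free_of_second_variable FG Gn0.
(* exchanging the variables exhibits m |-> F(m,0) as a polynomial *)
pose phi : {poly K} := (swapXY f).[0].
have phiE m n : F m n = phi.[m%:~R].
  by rewrite Fcst /F mulr0z -horner2_swapXY.
have [|a aE] := @additive_up_to_const_affine phi.
  by move=> i j k; have := FG i j k; rewrite !skew !phiE.
exists a, phi.[0] => m n; rewrite skew !phiE !aE intrD; split=> //; ring.
Qed.

End IntegerPoints.

(** * Brackets on a basis indexed by the integers *)

Section IntegerBasis.
Variables (K : comNzRingType) (V : lmodType {poly K}) (L : int -> V).
Hypothesis hL : is_basis L.
Variables (br : V -> V -> polymod V) (F G : int -> int -> K).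
Hypothesis hbr : lambda_bracket br.
Hypothesis brL : forall m n,
  br (L m) (L n) = partial_lambda (F m n) (G m n) *: constpm (L (m + n)).

Let C3 (k : K) : {poly {poly {poly K}}} := k%:P%:P%:P.
Let del : {poly {poly {poly K}}} := 'X%:P%:P.
Let lam : {poly {poly {poly K}}} := 'X%:P.
Let mu : {poly {poly {poly K}}} := 'X.
Let F3 m n := C3 (F m n).
Let G3 m n := C3 (G m n).

Lemma jacobi_outerE i j k :
  evalpm mu (bracket_at br lam (L i)) (br (L j) (L k)) =
  jacobi_outer F3 G3 i j k del lam mu *: constpm (constpm (L (i + j + k))).
Proof.
rewrite (evalpm_bracket_at_r hbr _ _ _ (brL j k)).
by rewrite (bracket_at_partial_lambda _ (brL _ _)) scalerA addrA.
Qed.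

Lemma jacobi_innerE i j k :
  evalpm lam (fun v => bracket_at br (lam + mu) v (L k)) (br (L i) (L j)) +
  evalpm lam (bracket_at br mu (L j)) (br (L i) (L k)) =
  jacobi_inner F3 G3 i j k del lam mu *: constpm (constpm (L (i + j + k))).
Proof.
rewrite (evalpm_bracket_at_l hbr _ _ _ (brL i j)).
rewrite (evalpm_bracket_at_r hbr _ _ _ (brL i k)).
rewrite !(bracket_at_partial_lambda _ (brL _ _)) !scalerA addrCA addrA.
by rewrite -scalerDl.
Qed.

Lemma skew_rhsE i j :
  - evalpm (- 'X - 'X%:P) (@constpm _ V) (br (L j) (L i)) =
  partial_lambda (G j i - F j i) (G j i) *: constpm (L (i + j)).
Proof.
rewrite brL (evalpm_partial_lambda _ _ _ _ (constpm_subst_linear V)).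
rewrite -scaleNr (addrC j i); congr (_ *: _).
by rewrite /partial_lambda -!mul_polyC polyCB; ring.
Qed.

Lemma scale_basis_inj i : injective (fun p : {poly K} => p *: L i).
Proof.
move=> p q /eqP; rewrite -subr_eq0 -scalerBl => /eqP pq.
apply/eqP; rewrite -subr_eq0; apply/eqP.
by apply: (proj2 hL [:: i] (fun _ => p - q) _ _ i); rewrite ?big_seq1 ?mem_head.
Qed.

(** The coefficient of lambda in skew symmetry says that G is symmetric, and
    that of partial gives F(m,n) = G(n,m) - F(n,m). *)
Lemma skew_symmetry_coefs : skew_symmetry br ->
  forall m n, G m n = F m n + F n m.
Proof.
move=> skew m n; have := skew (L m) (L n); rewrite skew_rhsE brL.
move/(scale_constpm_inj (@scale_basis_inj _)) => E.
have pE x y l d : (partial_lambda x y : {poly {poly K}}).[l%:P].[d] =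
    x * d + y * l.
  by rewrite /partial_lambda !hornerE.
have := congr1 (fun p : {poly {poly K}} => p.[0%:P].[1]) E.
have := congr1 (fun p : {poly {poly K}} => p.[1%:P].[0]) E.
by rewrite /= !pE !(mulr0, mulr1, addr0, add0r) => -> ->; ring.
Qed.

Lemma jacobi_identity_coefs : jacobi_identity br ->
  forall i j k d l u,
    jacobi_outer F G i j k d l u = jacobi_inner F G i j k d l u.
Proof.
move=> jac i j k d l u; have := jac (L i) (L j) (L k).
rewrite /= jacobi_outerE jacobi_innerE.
move/(scale_constpm_inj (scale_constpm_inj (@scale_basis_inj _))).
move/(congr1 (fun p : {poly {poly {poly K}}} => p.[u%:P%:P].[l%:P].[d])).
by rewrite /= /jacobi_outer /jacobi_inner /F3 /G3 /C3 /del /lam /mu !hornerE.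
Qed.

(** For these structure constants skew symmetry and the Jacobi identity on
    the L_i are identities of commutative rings. *)
Lemma affine_lie_conformal a c :
    (forall m n, F m n = a * m%:~R + c) ->
    (forall m n, G m n = a * (m + n)%:~R + 2 * c) ->
  lie_conformal_algebra br.
Proof.
move=> FE GE; split=> //.
  apply: (skew_symmetry_basis hbr hL) => m n.
  rewrite skew_rhsE brL; congr (partial_lambda _ _ *: _).
    by rewrite GE !FE intrD; ring.
  by rewrite !GE (addrC n).
apply: (jacobi_identity_basis hbr hL) => i j k.
rewrite jacobi_outerE jacobi_innerE; congr (_ *: _).
rewrite /jacobi_outer /jacobi_inner /F3 /G3 /C3 !GE !FE !intrD.
by rewrite !(polyCD, polyCM); ring.
Qed.

End IntegerBasis.

Theorem proposition2p6 (R : realType) (CW : lmodType {poly R[i]})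
    (L : int -> CW) (hL : is_basis L) :
  (forall br : CW -> CW -> polymod CW, lambda_bracket br ->
    (lie_conformal_algebra br /\
     exists f g : {poly {poly R[i]}}, forall m n : int,
       br (L m) (L n) =
       partial_lambda f.[m%:~R, n%:~R] g.[m%:~R, n%:~R] *: constpm (L (m + n)))
    <->
    (exists a c : R[i], forall m n : int,
       br (L m) (L n) =
       partial_lambda (a * m%:~R + c) (a * (m + n)%:~R + 2 * c)
         *: constpm (L (m + n)))) /\
  (forall a c : R[i], exists br : CW -> CW -> polymod CW,
     lie_conformal_algebra br /\
     forall m n : int,
       br (L m) (L n) =
       partial_lambda (a * m%:~R + c) (a * (m + n)%:~R + 2 * c)
         *: constpm (L (m + n))).
Proof.
split=> [br hbr|a c]; last first.
  have [br [hbr brL]] := lambda_bracket_exists (fun m n : int =>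
    partial_lambda (a * m%:~R + c) (a * (m + n)%:~R + 2 * c)
      *: constpm (L (m + n))) hL.
  by exists br; split=> //; apply: (affine_lie_conformal hL hbr brL).
split=> [[[_ skew jac] [f [g brL]]]|[a [c brL]]].
  have [a [c ac]] := jacobi_solutions
    (skew_symmetry_coefs hL brL skew) (jacobi_identity_coefs hL hbr brL jac).
  by exists a, c => m n; have [<- <-] := ac m n.
split; first exact: (affine_lie_conformal hL hbr brL).
exists (a%:P%:P * 'X + c%:P%:P).
exists (a%:P%:P * ('X + 'X%:P) + (2 * c)%:P%:P) => m n.
by rewrite brL !hornerE intrD.
Qed.
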